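(* Let $C$ be an absolute constant with the following property: for every $n\ge1$, all i.i.d. real random variables $Z_1,\ldots,Z_n$ with a non-degenerate log-concave density symmetric about $0$, and all $\alpha,\beta\in\mathbb{R}^n$ with $\alpha\ne0$, one has $\mathbf{P}\{|\langle\alpha,Z\rangle|\le|\langle\beta,Z\rangle|\}\le C\|\beta\|/\|\alpha\|$. Let $X_i=\xi_iY_i$ for $1\le i\le n$, where $Y_1,\ldots,Y_n$ are i.i.d. with a symmetric (about $0$) log-concave density, $\xi_1,\ldots,\xi_n$ are i.i.d. positive random variables with $\mathbf{E}[\xi_1^2]\le B$ and $\mathbf{E}[1/\xi_1^2]\le B$ for some $B$, and the $\xi_i$'s are independent of the $Y_i$'s. Then for all $\alpha,\beta\in\mathbb{R}^n$ with $\alpha\ne0$, $$\mathbf{P}\{|\langle\alpha,X\rangle|\le|\langle\beta,X\rangle|\}\le CB\,\frac{\|\beta\|}{\|\alpha\|}.$$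
   Context: For a random vector $W=(W_1,\ldots,W_n)$ and $\alpha\in\mathbb{R}^n$, $\langle\alpha,W\rangle=\sum_{i=1}^n\alpha_iW_i$; $\|\cdot\|$ is the Euclidean norm. A density is log-concave if it is of the form $e^{-g}$ with $g$ convex, taking values in $(-\infty,+\infty]$. An absolute constant $C$ with the stated property exists. *)

(* Defs.v *)
From mathcomp Require Import all_boot all_order all_algebra.
From mathcomp Require Import all_classical all_reals all_analysis.

Set Implicit Arguments.
Unset Strict Implicit.
Unset Printing Implicit Defensive.

Import Order.TTheory GRing.Theory Num.Theory.

Local Open Scope classical_set_scope.
Local Open Scope ring_scope.

(* The norm that MathComp-Analysis puts on 'rV[R]_n is the sup norm. *)
Definition euclidean_norm (R : realType) (n : nat) (a : 'rV[R]_n) : R :=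
  Num.sqrt (\sum_(i < n) a 0 i ^+ 2).

Definition linear_form (R : realType) (n : nat) (T : Type)
    (a : 'rV[R]_n) (W : 'I_n -> T -> R) (w : T) : R :=
  \sum_(i < n) a 0 i * W i w.

(* Convexity for functions that never take the value -oo; this way the
   right-hand side is never of the form +oo - oo. *)
Definition convex_ereal (R : realType) (g : R -> \bar R) : Prop :=
  forall t x y : R, 0 <= t <= 1 ->
    (g (t * x + (1 - t) * y)%R <= t%:E * g x + (1 - t)%R%:E * g y)%E.

Definition log_concave (R : realType) (f : R -> R) : Prop :=
  exists g : R -> \bar R,
    [/\ forall x, (-oo < g x)%E,
        convex_ereal g &
        forall x, (f x)%:E = expeR (- g x)%E].

Definition even_function (R : realType) (f : R -> R) : Prop :=
  forall x, f (- x) = f x.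

Definition has_density (R : realType) (d : measure_display)
    (T : measurableType d) (P : probability T R) (X : {RV P >-> R})
    (f : R -> R) : Prop :=
  [/\ measurable_fun [set: R] f,
      forall x, 0 <= f x &
      forall A : set R, measurable A ->
        distribution P X A = (\int[lebesgue_measure]_(x in A) (f x)%:E)%E].

Definition symmetric_log_concave (R : realType) (d : measure_display)
    (T : measurableType d) (P : probability T R) (X : {RV P >-> R}) : Prop :=
  exists f : R -> R, [/\ has_density X f, even_function f & log_concave f].

Definition nondegenerate_law (R : realType) (d : measure_display)
    (T : measurableType d) (P : probability T R) (X : {RV P >-> R}) : Prop :=
  forall c : R, P [set w | X w = c] <> 1%E.

(* Choosing A i = setT outside a subset of indices gives the product rule for
   every subfamily. *)
Definition mutually_independent (R : realType) (d : measure_display)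
    (T : measurableType d) (P : probability T R) (n : nat)
    (X : 'I_n -> {RV P >-> R}) : Prop :=
  forall A : 'I_n -> set R, (forall i, measurable (A i)) ->
    P (\bigcap_(i in [set: 'I_n]) (X i @^-1` A i)) =
    (\prod_(i < n) P (X i @^-1` A i))%E.

(* The laws are compared on Borel sets only: the values of a measure outside
   its sigma-algebra are unspecified. *)
Definition identically_distributed (R : realType) (d : measure_display)
    (T : measurableType d) (P : probability T R) (n : nat)
    (X : 'I_n -> {RV P >-> R}) : Prop :=
  forall (i j : 'I_n) (A : set R), measurable A ->
    distribution P (X i) A = distribution P (X j) A.

Definition iid (R : realType) (d : measure_display)
    (T : measurableType d) (P : probability T R) (n : nat)
    (X : 'I_n -> {RV P >-> R}) : Prop :=
  mutually_independent X /\ identically_distributed X.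

(* The sigma-algebras generated by the two families are independent. *)
Definition independent_families (R : realType) (d : measure_display)
    (T : measurableType d) (P : probability T R) (m n : nat)
    (X : 'I_m -> {RV P >-> R}) (Y : 'I_n -> {RV P >-> R}) : Prop :=
  forall A B : set T,
    g_sigma_preimage (fun i => X i : T -> R) A ->
    g_sigma_preimage (fun i => Y i : T -> R) B ->
    P (A `&` B) = (P A * P B)%E.

(* The dimension is written n.+1, so that it ranges over all n >= 1. *)
Definition comparison_constant (R : realType) (C : R) : Prop :=
  forall (n : nat) (d : measure_display) (T : measurableType d)
    (P : probability T R) (Z : 'I_n.+1 -> {RV P >-> R}),
    iid Z ->
    (forall i, nondegenerate_law (Z i)) ->
    (forall i, symmetric_log_concave (Z i)) ->
    forall a b : 'rV[R]_n.+1, a != 0 ->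
      (P [set w | (`|linear_form a Z w| <= `|linear_form b Z w|)%R] <=
       (C * (euclidean_norm b / euclidean_norm a))%:E)%E.

(* Main.v *)
Require Import Defs.
From HB Require Import structures.
From mathcomp Require Import all_boot all_order all_algebra.
From mathcomp Require Import all_classical all_reals all_analysis.
From mathcomp Require Import measurable_realfun ring lra.

Set Implicit Arguments.
Unset Strict Implicit.
Unset Printing Implicit Defensive.

Import Order.TTheory GRing.Theory Num.Theory.
Import numFieldNormedType.Exports.

Local Open Scope classical_set_scope.
Local Open Scope ring_scope.

(** Condition on the vector xi. Since X i = xi i * Y i, for each fixed value x
    of xi the forms <alpha, X> and <beta, X> are linear forms in Y with
    coefficients alpha_i x_i and beta_i x_i, so the hypothesis on C applies to Y
    and bounds the conditional probability by
    C * ||beta x|| / ||alpha x||, where a x is the coordinatewise product. The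
    law of each Y i has a density, hence is nondegenerate.

    It remains to show that the mean of ||beta xi|| / ||alpha xi|| is at most
    B * ||beta|| / ||alpha||. With the weights p_i = alpha_i^2 / ||alpha||^2 and
    q_i = beta_i^2 / ||beta||^2,
<<
      ||beta x|| / ||alpha x||
        = ||beta|| / ||alpha|| * sqrt (s / m),
      s = sum_i q_i x_i^2,   m = sum_i p_i x_i^2.
>>
    By the arithmetic-geometric mean inequality sqrt (s / m) <= (s + 1 / m) / 2,
    and Jensen's inequality for the convex map y |-> 1 / y gives
    1 / m <= sum_i p_i / x_i^2 ([jensen_inv], [norm_ratio_hadamard]). The
    resulting bound is linear in the x_i^2 and 1 / x_i^2, so its mean involves
    only the two moments of the common law of the xi i
    ([expectation_ratio_bound_le]).

    The conditioning is Tonelli's theorem: independence of the two families says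
    that the joint law of the random vectors xi and Y is the product of their
    laws ([independent_families_disintegration]). *)

(** * Norms of coordinatewise products *)

(** Jensen's inequality for y |-> 1 / y: average over the weights p the tangent
    lines of that map at the weighted mean m. *)
Lemma jensen_inv (R : realType) (I : finType) (p y : I -> R) :
  (forall i, 0 <= p i) -> \sum_i p i = 1 -> (forall i, 0 < y i) ->
  (\sum_i p i * y i)^-1 <= \sum_i p i / y i.
Proof.
move=> p0 p1 y0; set m := \sum_i p i * y i.
have m0 : 0 < m.
  have py0 i : true -> 0 <= p i * y i by rewrite mulr_ge0// ltW.
  rewrite lt0r sumr_ge0// andbT; apply: contra_neq (oner_neq0 R) => pye0.
  rewrite -p1 big1// => i _.
  have /eqP : p i * y i = 0 by exact: (psumr_eq0P py0 pye0).
  by rewrite mulf_eq0 [y i == 0]gt_eqF// orbF => /eqP.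
(* The tangent line at m lies below 1 / y, by a square. *)
have tangent i : 2 / m - y i / m ^+ 2 <= (y i)^-1.
  have yi := y0 i.
  rewrite -subr_ge0 (_ : _ - _ = (y i)^-1 * (1 - y i / m) ^+ 2).
    by rewrite mulr_ge0 ?sqr_ge0// invr_ge0 ltW.
  by field; rewrite !gt_eqF.
rewrite (@le_trans _ _ (\sum_i p i * (2 / m - y i / m ^+ 2)))//; last first.
  by apply: ler_sum => i _; rewrite ler_wpM2l.
under eq_bigr do rewrite mulrBr mulrA.
rewrite big_split/= sumrN -mulr_suml mulr_suml -mulr_suml -mulr_suml p1.
under [X in _ - X]eq_bigr do rewrite mulrA.
rewrite -mulr_suml -/m.
rewrite le_eqVlt; apply/orP; left; apply/eqP.
by field; rewrite gt_eqF.
Qed.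

Definition hadamard (R : realType) n (a : 'rV[R]_n) (x : 'I_n -> R) :
    'rV[R]_n :=
  \row_i (a 0 i * x i).

Definition sq_weight (R : realType) n (a : 'rV[R]_n) (i : 'I_n) : R :=
  a 0 i ^+ 2 / (\sum_(j < n) a 0 j ^+ 2).

Definition sq_mean (R : realType) n (a : 'rV[R]_n) (y : 'I_n -> R) : R :=
  \sum_(i < n) sq_weight a i * y i.

(** A majorant of (||b x|| / ||a x||) / (||b|| / ||a||) that is linear in the
    squares x_i^2 and their inverses, so that its mean under a random x is
    controlled by one-dimensional moments. *)
Definition ratio_bound (R : realType) n (a b : 'rV[R]_n) (x : 'I_n -> R) : R :=
  2^-1 * (sq_mean b (fun i => x i ^+ 2) + sq_mean a (fun i => (x i ^+ 2)^-1)).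

Section sq_weight_theory.
Variables (R : realType) (n : nat).
Implicit Types (a b : 'rV[R]_n) (x : 'I_n -> R).

Let sum_sq_ge0 a : 0 <= \sum_(j < n) a 0 j ^+ 2.
Proof. by apply: sumr_ge0 => i _; exact: sqr_ge0. Qed.

Lemma sq_weight_ge0 a i : 0 <= sq_weight a i.
Proof. by rewrite divr_ge0 ?sqr_ge0. Qed.

Lemma sum_sq_neq0 a : a != 0 -> \sum_(j < n) a 0 j ^+ 2 != 0.
Proof.
apply: contra_neq => s0; apply/rowP => i; rewrite mxE.
have /eqP : a 0 i ^+ 2 = 0.
  exact: (psumr_eq0P (fun j _ => sqr_ge0 (a 0 j)) s0).
by rewrite sqrf_eq0 => /eqP.
Qed.

Lemma sum_sq_weight a : a != 0 -> \sum_i sq_weight a i = 1.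
Proof. by move=> a0; rewrite -mulr_suml divff// sum_sq_neq0. Qed.

(** For a = 0 the weights are all 0 / 0 = 0, so only an inequality survives; it
    lets beta = 0 be treated along with the other cases. *)
Lemma sum_sq_weight_le1 a : \sum_i sq_weight a i <= 1.
Proof.
have [->|a0] := eqVneq a 0; last by rewrite sum_sq_weight.
by rewrite big1 ?ler01// => i _; rewrite /sq_weight mxE expr0n mul0r.
Qed.

Lemma sq_mean_ge0 a y : (forall i, 0 <= y i) -> 0 <= sq_mean a y.
Proof.
by move=> y0; apply: sumr_ge0 => i _; rewrite mulr_ge0 ?sq_weight_ge0.
Qed.

Lemma euclidean_norm_ge0 a : 0 <= euclidean_norm a.
Proof. exact: sqrtr_ge0. Qed.

Lemma euclidean_norm_gt0 a : a != 0 -> 0 < euclidean_norm a.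
Proof. by move=> a0; rewrite sqrtr_gt0 lt0r sum_sq_neq0/=. Qed.

Lemma euclidean_norm_hadamard a x :
  euclidean_norm (hadamard a x) =
  euclidean_norm a * Num.sqrt (sq_mean a (fun i => x i ^+ 2)).
Proof.
rewrite /euclidean_norm -sqrtrM//; congr Num.sqrt.
under eq_bigr do rewrite mxE exprMn.
have [->|a0] := eqVneq a 0.
  rewrite [X in _ = X * _]big1 ?mul0r; last by move=> i _; rewrite mxE expr0n.
  by rewrite big1// => i _; rewrite mxE expr0n mul0r.
rewrite mulr_sumr; apply: eq_bigr => i _.
by rewrite [RHS]mulrA [X in _ = X * _]mulrC divfK// sum_sq_neq0.
Qed.

Lemma hadamard_neq0 a x : (forall i, 0 < x i) -> a != 0 -> hadamard a x != 0.
Proof.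
move=> x0; apply: contra_neq => /rowP h; apply/rowP => i; have := h i.
by rewrite !mxE => /eqP; rewrite mulf_eq0 [x i == 0]gt_eqF// orbF => /eqP.
Qed.

Lemma ratio_bound_ge0 a b x : 0 <= ratio_bound a b x.
Proof.
rewrite mulr_ge0// addr_ge0//; apply: sq_mean_ge0 => i.
  exact: sqr_ge0.
by rewrite invr_ge0 sqr_ge0.
Qed.

(** Factoring the norms of a and b out leaves the square root of the ratio of
    two weighted means of the x_i^2; the arithmetic-geometric mean inequality
    and [jensen_inv] linearize it. *)
Lemma norm_ratio_hadamard a b x : a != 0 -> (forall i, 0 < x i) ->
  euclidean_norm (hadamard b x) / euclidean_norm (hadamard a x) <=
  euclidean_norm b / euclidean_norm a * ratio_bound a b x.
Proof.
move=> a0 x0; rewrite !euclidean_norm_hadamard invfM mulrACA.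
apply: ler_wpM2l; first by rewrite divr_ge0 ?euclidean_norm_ge0.
rewrite /ratio_bound; set s := sq_mean b _; set m := sq_mean a _.
set t := sq_mean a _.
have s0 : 0 <= s by apply: sq_mean_ge0 => i; exact: sqr_ge0.
have m0 : 0 <= m by apply: sq_mean_ge0 => i; exact: sqr_ge0.
have mt : m^-1 <= t.
  apply: jensen_inv; [exact: sq_weight_ge0|exact: sum_sq_weight|].
  by move=> i; rewrite exprn_gt0.
rewrite -sqrtrV//.
apply: (@le_trans _ _ (2^-1 * (s + m^-1))); last by rewrite ler_wpM2l// lerD2l.
(* Arithmetic-geometric mean inequality for s and 1 / m. *)
have := sqr_ge0 (Num.sqrt s - Num.sqrt m^-1).
rewrite sqrrB !sqr_sqrtr ?invr_ge0//.
lra.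
Qed.

End sq_weight_theory.

(** * Conditioning on one of two independent families *)

Section random_vector.
Context d (T : measurableType d) (R : realType) (P : probability T R).
Variables (n : nat) (X : 'I_n -> {RV P >-> R}).

Definition random_vector : T -> n.-tuple R := fun w => [tuple X i w | i < n].

Lemma measurable_random_vector : measurable_fun [set: T] random_vector.
Proof.
apply/measurable_fun_tnthP => i.
rewrite (_ : _ \o _ = X i)//.
by apply/funext => w /=; rewrite tnth_mktuple.
Qed.

HB.instance Definition _ := isMeasurableFun.Build _ _ _ _ random_vector
  measurable_random_vector.

(** The sigma-algebra of a family is the one pulled back by its random vector;
    this turns independence of families into independence of vectors. *)
Lemma g_sigma_preimage_random_vector (A : set (n.-tuple R)) :
  measurable A ->
  g_sigma_preimage (fun i => X i : T -> R) (random_vector @^-1` A).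
Proof.
move=> mA.
rewrite (_ : (fun i => _) = (fun i => (fun t => tnth t i) \o random_vector)).
  by rewrite g_sigma_preimage_comp; exists A => //; rewrite setTI.
by apply/funext => i; apply/funext => w /=; rewrite tnth_mktuple.
Qed.

End random_vector.

Section disintegration.
Context d (T : measurableType d) (R : realType) (P : probability T R).
Variables (m n : nat) (X : 'I_m -> {RV P >-> R}) (Y : 'I_n -> {RV P >-> R}).
Variable S : set (m.-tuple R * n.-tuple R).
Hypothesis mS : measurable S.

Let section_prob w := P [set w' | S (random_vector X w, random_vector Y w')].

Let section_probE :
  section_prob =
  distribution P (random_vector Y) \o xsection S \o random_vector X.
Proof.
apply/funext => w; congr (P _).
by apply/seteqP; split=> w' /=; rewrite /xsection /= inE.
Qed.

Lemma measurable_section_prob : measurable_fun [set: T] section_prob.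
Proof.
rewrite section_probE.
apply: measurableT_comp; last exact: measurable_random_vector.
exact: measurable_fun_xsection.
Qed.

(** The joint law of the two random vectors agrees with the product of their
    laws on rectangles, hence everywhere; the right-hand side is the mass that
    the product measure gives to S, computed by sections. *)
Lemma independent_families_disintegration : independent_families X Y ->
  P [set w | S (random_vector X w, random_vector Y w)] =
  (\int[P]_w section_prob w)%E.
Proof.
move=> XY; pose VW w := (random_vector X w, random_vector Y w).
have mVW : measurable_fun [set: T] VW.
  by apply: measurable_fun_pair; exact: measurable_random_vector.
pose VWm : {mfun T >-> (m.-tuple R * n.-tuple R)%type} :=
  HB.pack VW (isMeasurableFun.Build _ _ _ _ VW mVW).
have prodE A B : measurable A -> measurable B ->
    distribution P VWm (A `*` B) =
    (distribution P (random_vector X) A * distribution P (random_vector Y) B)%E.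
  by move=> mA mB; apply: XY; exact: g_sigma_preimage_random_vector.
transitivity (distribution P VWm S); first by [].
rewrite -(product_measure_unique prodE mS) section_probE.
rewrite /product_measure1 ge0_integral_distribution//.
exact: measurable_fun_xsection.
Qed.

End disintegration.

(** * The comparison constant *)

(** A law with a density has no atoms. *)
Lemma has_density_nondegenerate (R : realType) d (T : measurableType d)
    (P : probability T R) (X : {RV P >-> R}) (f : R -> R) :
  has_density X f -> nondegenerate_law X.
Proof.
move=> [_ _ Xf] c; have := Xf [set c] (measurable_set1 c).
rewrite integral_set1 /distribution /pushforward => Xc0 Xc1.
suff : (0 : \bar R) = 1%E by move=> [] /esym/eqP; rewrite oner_eq0.
by rewrite -Xc0 -Xc1.
Qed.

(** Comparing a nonzero linear form with itself gives 1 <= C; this needs some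
    family Z to which the defining property of C applies. *)
Lemma comparison_constant_ge0 (R : realType) (C : R)
    (hC : comparison_constant C) n d (T : measurableType d)
    (P : probability T R) (Z : 'I_n.+1 -> {RV P >-> R}) :
  iid Z -> (forall i, nondegenerate_law (Z i)) ->
  (forall i, symmetric_log_concave (Z i)) -> 0 <= C.
Proof.
move=> Ziid Znd Zlc.
have u0 : const_mx 1 != 0 :> 'rV[R]_n.+1.
  by apply/eqP => /rowP/(_ ord0); rewrite !mxE => /eqP; rewrite oner_eq0.
have := hC n d T P Z Ziid Znd Zlc (const_mx 1) (const_mx 1) u0.
rewrite divff ?gt_eqF ?euclidean_norm_gt0// mulr1.
rewrite (_ : [set _ | _] = setT); last first.
  by apply/seteqP; split => w //= _; exact: lexx.
by rewrite probability_setT lee_fin; exact: le_trans.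
Qed.

(** * The mean of the ratio of the norms *)

(** The inverse is continuous away from 0, and restricted to the measurable
    singleton {0} every map is measurable. *)
Lemma measurable_invr (R : realType) : measurable_fun [set: R] (@GRing.inv R).
Proof.
rewrite -(setUv [set 0]); apply/measurable_funU => //.
  exact: measurableC.
split; first exact: measurable_fun_set1.
apply: open_continuous_measurable_fun.
  have -> : ~` [set 0] = [set x : R | x != 0].
    by apply/seteqP; split => x /= /eqP.
  exact: open_neq.
by move=> x; rewrite inE/= => /eqP; exact: inv_continuous.
Qed.

Section mean_ratio_bound.
Context d (T : measurableType d) (R : realType) (P : probability T R).
Variables (n : nat) (xi : 'I_n.+1 -> {RV P >-> R}) (B : R).
Hypothesis idxi : identically_distributed xi.
Implicit Types (a b : 'rV[R]_n.+1).

Section moment.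
Variable h : R -> R.
Hypotheses (mh : measurable_fun [set: R] h) (h0 : forall x, 0 <= h x).

Lemma measurable_sq_mean a :
  measurable_fun [set: T] (fun w => sq_mean a (fun i => h (xi i w))).
Proof.
apply: measurable_sum => i; apply: measurable_funM => //.
exact: measurableT_comp.
Qed.

Lemma integral_identically_distributed i :
  (\int[P]_w (h (xi i w))%:E = \int[P]_w (h (xi ord0 w))%:E)%E.
Proof.
have mEh : measurable_fun [set: R] (EFin \o h) by exact/measurable_EFinP.
have Eh0 y : (0 <= (EFin \o h) y)%E by rewrite lee_fin.
rewrite -[LHS](ge0_integral_distribution (xi i) mEh Eh0).
rewrite -[RHS](ge0_integral_distribution (xi ord0) mEh Eh0).
by apply: eq_measure_integral => A mA _; exact: idxi.
Qed.

(** The weights sum to at most 1, and B is nonnegative because it bounds the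
    mean of a nonnegative variable. *)
Lemma expectation_sq_mean_le a : ('E_P[fun w => h (xi ord0 w)] <= B%:E)%E ->
  ('E_P[fun w => sq_mean a (fun i => h (xi i w))] <= B%:E)%E.
Proof.
rewrite unlock => hB.
have B0 : 0 <= B.
  rewrite -lee_fin; apply: le_trans hB.
  by apply: integral_ge0 => w _; rewrite lee_fin.
have mhxi i : measurable_fun [set: T] (fun w => h (xi i w)).
  exact: measurableT_comp.
under eq_integral do rewrite -sumEFin.
rewrite ge0_integral_sum//; last 2 first.
- by move=> i; apply/measurable_EFinP/measurable_funM.
- by move=> i w _; rewrite lee_fin mulr_ge0 ?sq_weight_ge0.
apply: (@le_trans _ _ (\sum_i (sq_weight a i)%:E * B%:E)%E).
  apply: lee_sum => i _; under eq_integral do rewrite EFinM.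
  rewrite ge0_integralZl_EFin ?sq_weight_ge0//; last 2 first.
  - by move=> w _; rewrite lee_fin.
  - exact/measurable_EFinP.
  apply: lee_wpmul2l; first by rewrite lee_fin sq_weight_ge0.
  by rewrite integral_identically_distributed.
rewrite -ge0_sume_distrl; last by move=> i _; rewrite lee_fin sq_weight_ge0.
by rewrite sumEFin -EFinM lee_fin ler_piMl// sum_sq_weight_le1.
Qed.

End moment.

Let msqr : measurable_fun [set: R] (fun x : R => x ^+ 2).
Proof. exact: measurable_funX. Qed.

Let msqrV : measurable_fun [set: R] (fun x : R => (x ^+ 2)^-1).
Proof. by apply: measurableT_comp => //; exact: measurable_invr. Qed.

Let sqrV_ge0 (x : R) : 0 <= (x ^+ 2)^-1.
Proof. by rewrite invr_ge0 sqr_ge0. Qed.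

Lemma measurable_ratio_bound a b :
  measurable_fun [set: T] (fun w => ratio_bound a b (xi ^~ w)).
Proof.
apply: measurable_funM => //; apply: measurable_funD.
  exact: (measurable_sq_mean msqr).
exact: (measurable_sq_mean msqrV).
Qed.

Lemma expectation_ratio_bound_le a b :
  ('E_P[fun w => (xi ord0 w ^+ 2)%R] <= B%:E)%E ->
  ('E_P[fun w => ((xi ord0 w ^+ 2)^-1)%R] <= B%:E)%E ->
  ('E_P[fun w => ratio_bound a b (xi ^~ w)] <= B%:E)%E.
Proof.
move=> /(expectation_sq_mean_le msqr (@sqr_ge0 R) b) sB.
move=> /(expectation_sq_mean_le msqrV sqrV_ge0 a) tB.
move: sB tB; rewrite unlock => sB tB.
under eq_integral do rewrite /ratio_bound EFinM EFinD.
have s0 w : 0 <= sq_mean b (fun i => xi i w ^+ 2).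
  by apply: sq_mean_ge0 => i; exact: sqr_ge0.
have t0 w : 0 <= sq_mean a (fun i => (xi i w ^+ 2)^-1) by exact: sq_mean_ge0.
have ms := measurable_sq_mean msqr b.
have mt := measurable_sq_mean msqrV a.
rewrite ge0_integralZl_EFin//; last 2 first.
- by move=> w _; rewrite -EFinD lee_fin addr_ge0.
- by apply/measurable_EFinP/measurable_funD.
rewrite ge0_integralD//; try (by move=> w _; rewrite lee_fin);
  try exact/measurable_EFinP.
apply: (@le_trans _ _ (2^-1%:E * (B%:E + B%:E))%E).
  by apply: lee_wpmul2l; [rewrite lee_fin|exact: leeD].
by rewrite -EFinD -EFinM lee_fin; lra.
Qed.

End mean_ratio_bound.

(** * The inequality for the products *)

Theorem corollary4 (R : realType) (C : R) (hC : comparison_constant C)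
    (n : nat) (d : measure_display) (T : measurableType d)
    (P : probability T R)
    (X Y xi : 'I_n.+1 -> {RV P >-> R}) (B : R)
    (hX : forall i w, X i w = xi i w * Y i w)
    (hYiid : iid Y)
    (hYlc : forall i, symmetric_log_concave (Y i))
    (hxiiid : iid xi)
    (hxipos : forall i, {ae P, forall w, 0 < xi i w})
    (hxi2 : ('E_P[fun w => (xi ord0 w ^+ 2)%R] <= B%:E)%E)
    (hxiV2 : ('E_P[fun w => ((xi ord0 w ^+ 2)^-1)%R] <= B%:E)%E)
    (hindep : independent_families xi Y)
    (alpha beta : 'rV[R]_n.+1) (halpha : alpha != 0) :
  (P [set w | (`|linear_form alpha X w| <= `|linear_form beta X w|)%R] <=
   (C * B * (euclidean_norm beta / euclidean_norm alpha))%:E)%E.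
Proof.
have Ynd i : nondegenerate_law (Y i).
  by have [f [Yf _ _]] := hYlc i; exact: has_density_nondegenerate Yf.
have C0 := comparison_constant_ge0 hC hYiid Ynd hYlc.
(* <a, X> as a function of a value of xi and a value of Y. *)
pose coord_sum (a : 'rV[R]_n.+1) (z : n.+1.-tuple R * n.+1.-tuple R) : R :=
  \sum_i hadamard a (tnth z.1) 0 i * tnth z.2 i.
have mcoord_sum a : measurable_fun setT (coord_sum a).
  apply: measurable_sum => i; apply: measurable_funM.
    under eq_fun do rewrite mxE.
    apply: measurable_funM => //.
    apply: (@measurableT_comp _ _ _ _ _ _ (fun t => tnth t i)) => //.
    exact: measurable_tnth.
  apply: (@measurableT_comp _ _ _ _ _ _ (fun t => tnth t i)) => //.
  exact: measurable_tnth.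
pose S := [set z | `|coord_sum alpha z| <= `|coord_sum beta z|].
have mS : measurable S.
  rewrite -[S]setTI; apply: measurable_fun_le => //; exact: measurableT_comp.
have coord_sumE a w w' :
    coord_sum a (random_vector xi w, random_vector Y w') =
    linear_form (hadamard a (xi ^~ w)) Y w'.
  by apply: eq_bigr => i _; rewrite !mxE !tnth_mktuple.
have linXE a w : linear_form a X w = linear_form (hadamard a (xi ^~ w)) Y w.
  by apply: eq_bigr => i _; rewrite hX mxE mulrA.
rewrite (_ : [set w | _] =
    [set w | S (random_vector xi w, random_vector Y w)]); last first.
  by apply/seteqP; split => w; rewrite /S /= !coord_sumE !linXE.
rewrite (independent_families_disintegration mS hindep).
set K := euclidean_norm beta / euclidean_norm alpha.
have K0 : 0 <= K by rewrite divr_ge0 ?euclidean_norm_ge0.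
have CK0 : 0 <= C * K by exact: mulr_ge0.
have mr := measurable_ratio_bound xi alpha beta.
apply: (@le_trans _ _
    (\int[P]_w ((C * K)%:E * (ratio_bound alpha beta (xi ^~ w))%:E))%E);
  last first.
  rewrite ge0_integralZl_EFin//; last 2 first.
  - by move=> w _; rewrite lee_fin ratio_bound_ge0.
  - exact/measurable_EFinP.
  rewrite [C * B * K]mulrAC [(C * K * B)%:E]EFinM.
  apply: lee_wpmul2l; first by rewrite lee_fin.
  have := expectation_ratio_bound_le hxiiid.2 alpha beta hxi2 hxiV2.
  by rewrite unlock.
(* The comparison hypothesis requires nonzero coefficients alpha_i xi_i, which
   holds only almost surely. *)
apply: ae_ge0_le_integral => //.
- exact: measurable_section_prob.
- by move=> w _; rewrite mule_ge0// lee_fin ratio_bound_ge0.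
- by under eq_fun do rewrite -EFinM; apply/measurable_EFinP/measurable_funM.
have : {ae P, forall w i, 0 < xi i w} by exact: filter_forall.
apply: filterS => w xi0 _; rewrite -EFinM.
have h := hC n d T P Y hYiid Ynd hYlc (hadamard alpha (xi ^~ w))
  (hadamard beta (xi ^~ w)) (hadamard_neq0 xi0 halpha).
rewrite (_ : [set _ | _] =
    [set w' | `|linear_form (hadamard alpha (xi ^~ w)) Y w'| <=
              `|linear_form (hadamard beta (xi ^~ w)) Y w'|]); last first.
  by apply/seteqP; split => w'; rewrite /S /= !coord_sumE.
apply: (le_trans h); rewrite lee_fin -mulrA ler_wpM2l//.
exact: norm_ratio_hadamard.
Qed.
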